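(* Let $K_0$ be a nonempty compact convex subset of the plane $\mathbb{R}^2$. Then the following three conditions are equivalent. (i) $K_0$ is a disk. (ii) For every $K_1\subseteq\mathbb{R}^2$ and for arbitrary points $A_0,A_1,A_2\in\mathbb{R}^2$, if $K_1$ is similar to $K_0$ and both $K_0$ and $K_1$ are contained in the triangle $\mathrm{Conv}(\{A_0,A_1,A_2\})$, then there exist a $j\in\{0,1,2\}$ and a $k\in\{0,1\}$ such that $K_{1-k}\subseteq \mathrm{Conv}\bigl(K_k\cup(\{A_0,A_1,A_2\}\setminus\{A_j\})\bigr)$. (iii) For every $K_1\subseteq\mathbb{R}^2$ and for arbitrary points $A_0,A_1,A_2\in\mathbb{R}^2$, if $K_1$ is isometric to $K_0$ and both $K_0$ and $K_1$ are contained in the triangle $\mathrm{Conv}(\{A_0,A_1,A_2\})$, then there exist a $j\in\{0,1,2\}$ and a $k\in\{0,1\}$ such that $K_{1-k}\subseteq \mathrm{Conv}\bigl(K_k\cup(\{A_0,A_1,A_2\}\setminus\{A_j\})\bigr)$.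
   Context: $\mathrm{Conv}(X)$ denotes the usual convex hull of $X\subseteq\mathbb{R}^2$, i.e. the smallest convex subset of $\mathbb{R}^2$ containing $X$. Subsets $X,Y\subseteq\mathbb{R}^2$ are similar (respectively isometric, also called congruent) if $Y=\varphi(X)$ for some similarity transformation (respectively isometric transformation) $\varphi\colon\mathbb{R}^2\to\mathbb{R}^2$; orientation-reversing maps are allowed. A disk is the convex hull of a circle (a closed disk); singleton subsets of $\mathbb{R}^2$ count as disks and as circles. The points $A_0,A_1,A_2$ are arbitrary, so the triangle may be degenerate. *)

(* Defs.v *)
From HB Require Import structures.
From mathcomp Require Import all_boot all_order all_algebra.
From mathcomp Require Import all_classical all_reals all_analysis.

Set Implicit Arguments.
Unset Strict Implicit.
Unset Printing Implicit Defensive.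

Import Order.TTheory GRing.Theory Num.Theory.
Import numFieldNormedType.Exports.

Local Open Scope classical_set_scope.
Local Open Scope ring_scope.

(* The library norm on row vectors is the sup norm, hence this separate
   distance; the two norms induce the same topology, so that the library's
   [compact] is the usual notion. *)
Definition edist (R : realType) (x y : 'rV[R]_2) : R :=
  Num.sqrt (\sum_(i < 2) (x ord0 i - y ord0 i) ^+ 2).

Definition Conv (R : realType) (X : set 'rV[R]_2) : set 'rV[R]_2 :=
  smallest (@convex_set R 'rV[R]_2) X.

Definition circle (R : realType) (c : 'rV[R]_2) (r : R) : set 'rV[R]_2 :=
  [set x | edist x c = r].

(* Radius 0 is allowed, so singletons are disks. *)
Definition is_disk (R : realType) (D : set 'rV[R]_2) : Prop :=
  exists c : 'rV[R]_2, exists2 r : R, 0 <= r & D = Conv (circle c r).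

(* Surjectivity and affineness are automatic in the plane; reflections are
   included. *)
Definition is_similarity (R : realType) (phi : 'rV[R]_2 -> 'rV[R]_2) : Prop :=
  exists2 r : R, 0 < r & forall x y, edist (phi x) (phi y) = r * edist x y.

Definition is_isometry (R : realType) (phi : 'rV[R]_2 -> 'rV[R]_2) : Prop :=
  forall x y, edist (phi x) (phi y) = edist x y.

Definition are_similar (R : realType) (X Y : set 'rV[R]_2) : Prop :=
  exists2 phi : 'rV[R]_2 -> 'rV[R]_2, is_similarity phi & Y = phi @` X.

Definition are_isometric (R : realType) (X Y : set 'rV[R]_2) : Prop :=
  exists2 phi : 'rV[R]_2 -> 'rV[R]_2, is_isometry phi & Y = phi @` X.

(* The index k in {0, 1} is a boolean, so that 1 - k is ~~ k.  The set
   difference removes the point A j, hence every vertex equal to it when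
   the triangle is degenerate. *)
Definition one_in_hull_of_other (R : realType)
    (K0 K1 : set 'rV[R]_2) (A : 'I_3 -> 'rV[R]_2) : Prop :=
  let K (k : bool) := if k then K1 else K0 in
  exists (j : 'I_3) (k : bool),
    K (~~ k) `<=` Conv (K k `|` (range A `\` [set A j])).

(* Main.v *)
Require Import Defs.
From HB Require Import structures.
From mathcomp Require Import all_boot all_order all_algebra.
From mathcomp Require Import all_classical all_reals all_analysis.
From mathcomp Require Import ring lra.

Set Implicit Arguments.
Unset Strict Implicit.
Unset Printing Implicit Defensive.

Import Order.TTheory GRing.Theory Num.Theory.
Import numFieldNormedType.Exports.

Local Open Scope classical_set_scope.
Local Open Scope ring_scope.

(** Write h_K(n) for the maximum of the linear functional n on a compact set K.
    Everything is read off from the sign of f(n) = h_K1(n) - h_K0(n) as n turns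
    around the circle of directions.

    Discs have the hull property.  A point of K1 outside the hull of K0 and of
    the vertices other than A_j is cut off by a linear functional n.  As K1 lies
    in the triangle, n belongs to the open cone N_j of functionals whose maximum
    over the triangle is attained at A_j only, and f(n) > 0 ([disc_cap]).
    If all six inclusions fail, each of N_0, N_1, N_2 contains directions
    where f > 0 and directions where f < 0, hence, being convex, a zero of f.  For
    discs with centres c0, c1 and radii r0, r1 the zeros of f on the unit circle
    are the unit vectors n with n.(c1 - c0) = r0 - r1, so there are at most two
    of them ([unit_dot_two]), whereas the cones N_j are disjoint: a
    contradiction ([discs_one_in_hull]).  If two vertices coincide, everything
    lies on a line, and an order argument replaces the count of zeros.

    The isometric hull property forces a disc.  Suppose that f alternates in
    sign along four directions w, x, y, u in cyclic order, say with K1 sticking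
    out at x and u, and K0 at y and w.  Take the triangle formed by the support
    lines of the union of K0 and K1 with normals x, y and a suitable third
    normal s between u and w.  Near each of its vertices both sets stick out, in the
    directions w and almost x, almost x and almost y, almost y and u
    respectively, so that all six inclusions fail ([triangle_refutes]).  Now let
    K1 be the mirror image of K0 in a line of direction a, translated by a
    multiple c of the normal a' of the axis.  Then
    f(n) = h(mirror n) - h(n) + c a'.n is antisymmetric under the mirror, so two
    opposite signs on one side of the axis already give four alternating
    signs.  The real number c can be chosen to produce them unless the quotient
    of h(mirror n) - h(n) by a'.n is constant; so this quotient is constant, which
    means that K0 has a symmetry axis in every direction ([axis_defect]).  Two
    perpendicular axes give a centre of symmetry o; all other axes must pass
    through o, so h(n) - n.o is invariant under all mirrors, hence constant on the
    unit circle, and K0 is a disc with centre o. *)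

(** * Plane vectors *)

Definition dot (R : realType) (x y : 'rV[R]_2) : R :=
  x ord0 0 * y ord0 0 + x ord0 1 * y ord0 1.

Definition cross (R : realType) (x y : 'rV[R]_2) : R :=
  x ord0 0 * y ord0 1 - x ord0 1 * y ord0 0.

Definition vec (R : realType) (a b : R) : 'rV[R]_2 :=
  \row_(i < 2) if i == 0 then a else b.

Lemma vec0 (R : realType) (a b : R) : vec a b ord0 0 = a.
Proof. by rewrite mxE. Qed.

Lemma vec1 (R : realType) (a b : R) : vec a b ord0 1 = b.
Proof. by rewrite mxE. Qed.

Lemma vecP (R : realType) (x y : 'rV[R]_2) :
  x ord0 0 = y ord0 0 -> x ord0 1 = y ord0 1 -> x = y.
Proof.
move=> h0 h1; apply/rowP => -[[|[|//]] i2].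
- by have -> : Ordinal i2 = 0 by exact: val_inj.
- by have -> : Ordinal i2 = 1 by exact: val_inj.
Qed.

Lemma dotC (R : realType) (x y : 'rV[R]_2) : dot x y = dot y x.
Proof. by rewrite /dot; ring. Qed.

Lemma dotDr (R : realType) (n x y : 'rV[R]_2) : dot n (x + y) = dot n x + dot n y.
Proof. by rewrite /dot !mxE; ring. Qed.

Lemma dotBr (R : realType) (n x y : 'rV[R]_2) : dot n (x - y) = dot n x - dot n y.
Proof. by rewrite /dot !mxE; ring. Qed.

Lemma dotZr (R : realType) (n : 'rV[R]_2) t x : dot n (t *: x) = t * dot n x.
Proof. by rewrite /dot !mxE; ring. Qed.

Lemma dotDl (R : realType) (x y n : 'rV[R]_2) : dot (x + y) n = dot x n + dot y n.
Proof. by rewrite /dot !mxE; ring. Qed.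

Lemma dotBl (R : realType) (x y n : 'rV[R]_2) : dot (x - y) n = dot x n - dot y n.
Proof. by rewrite /dot !mxE; ring. Qed.

Lemma dotZl (R : realType) (n : 'rV[R]_2) t x : dot (t *: x) n = t * dot x n.
Proof. by rewrite /dot !mxE; ring. Qed.

Lemma dot0l (R : realType) (n : 'rV[R]_2) : dot 0 n = 0.
Proof. by rewrite /dot !mxE; ring. Qed.

Definition dotE := (dotDr, dotBr, dotZr, dotDl, dotBl, dotZl).

Lemma dot_ge0 (R : realType) (x : 'rV[R]_2) : 0 <= dot x x.
Proof. by rewrite /dot -!expr2 addr_ge0 ?sqr_ge0. Qed.

Lemma dot_eq0 (R : realType) (x : 'rV[R]_2) : dot x x = 0 -> x = 0.
Proof.
rewrite /dot -!expr2 => /eqP; rewrite paddr_eq0 ?sqr_ge0// !sqrf_eq0.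
by case/andP => /eqP h0 /eqP h1; apply: vecP; rewrite ?h0 ?h1 mxE.
Qed.

Lemma dot_gt0 (R : realType) (x : 'rV[R]_2) : x != 0 -> 0 < dot x x.
Proof.
by move=> x0; rewrite lt_def dot_ge0 andbT; apply: contraNneq x0 => /dot_eq0 ->.
Qed.

Lemma edistE (R : realType) (x y : 'rV[R]_2) :
  Defs.edist x y = Num.sqrt (dot (x - y) (x - y)).
Proof.
rewrite /Defs.edist /dot !big_ord_recl big_ord0 addr0 !mxE -!expr2.
by have -> : lift ord0 ord0 = 1 :> 'I_2 by exact: val_inj.
Qed.

Lemma edist_sqr (R : realType) (x y : 'rV[R]_2) :
  Defs.edist x y ^+ 2 = dot (x - y) (x - y).
Proof. by rewrite edistE sqr_sqrtr // dot_ge0. Qed.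

Lemma cauchy_schwarz (R : realType) (x y : 'rV[R]_2) :
  dot x y ^+ 2 <= dot x x * dot y y.
Proof.
rewrite -subr_ge0 (_ : _ - _ = cross x y ^+ 2) ?sqr_ge0//.
by rewrite /dot /cross; ring.
Qed.

Lemma dot_le_norm (R : realType) (x y : 'rV[R]_2) :
  dot x y <= Num.sqrt (dot x x) * Num.sqrt (dot y y).
Proof.
apply: le_trans (ler_norm _) _.
by rewrite -sqrtr_sqr -sqrtrM ?dot_ge0 // ler_wsqrtr ?cauchy_schwarz.
Qed.

(** Two independent linear functionals are coordinates of the plane; this and
    the next lemma (existence of the point with given coordinates) spare all
    explicit formulas for intersections of lines. *)
Lemma dot_ext (R : realType) (x y p q : 'rV[R]_2) : cross x y != 0 ->
  dot x p = dot x q -> dot y p = dot y q -> p = q.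
Proof.
move=> xy0 hx hy; apply: vecP; apply: (mulfI xy0).
- transitivity (y ord0 1 * dot x p - x ord0 1 * dot y p);
    first by rewrite /dot /cross; ring.
  by rewrite hx hy /dot /cross; ring.
- transitivity (x ord0 0 * dot y p - y ord0 0 * dot x p);
    first by rewrite /dot /cross; ring.
  by rewrite hx hy /dot /cross; ring.
Qed.

Lemma dot_solve (R : realType) (x y : 'rV[R]_2) (a b : R) : cross x y != 0 ->
  exists p, dot x p = a /\ dot y p = b.
Proof.
move=> xy0; exists ((cross x y)^-1 *:
  vec (a * y ord0 1 - b * x ord0 1) (b * x ord0 0 - a * y ord0 0)).
by rewrite !dotZr /dot !vec0 !vec1; split; apply: (mulfI xy0); rewrite mulVKf//;
   rewrite /cross; ring.
Qed.

(** * Convex hulls and separation *)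

Lemma convexP (R : realType) (A : set 'rV[R]_2) : @convex_set R 'rV[R]_2 A <->
  forall x y t, 0 <= t -> t <= 1 -> A x -> A y -> A (t *: x + (1 - t) *: y).
Proof.
split=> [cA x y t t0 t1 Ax Ay|cA x y l].
  have t01 : ((0 : R) <= t <= 1)%R by rewrite t0 t1.
  by have := cA x y (Itv01 t0 t1); rewrite !inE; exact.
rewrite !inE => Ax Ay; exact: cA.
Qed.

Lemma sub_Conv (R : realType) (X : set 'rV[R]_2) : X `<=` Conv X.
Proof. exact: sub_gen_smallest. Qed.

Lemma Conv_sub (R : realType) (X Y : set 'rV[R]_2) :
  (forall x y t, 0 <= t -> t <= 1 -> Y x -> Y y -> Y (t *: x + (1 - t) *: y)) ->
  X `<=` Y -> Conv X `<=` Y.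
Proof. by move=> /convexP; exact: smallest_sub. Qed.

Lemma Conv_convex (R : realType) (X : set 'rV[R]_2) x y t :
  0 <= t -> t <= 1 -> Conv X x -> Conv X y -> Conv X (t *: x + (1 - t) *: y).
Proof.
move=> t0 t1 hx hy Y [cY XY]; move/convexP : (cY) => h.
by apply: h => //; [apply: hx|apply: hy].
Qed.

Lemma avg_lt (R : realType) (t u v a : R) :
  0 <= t -> t <= 1 -> u < a -> v < a -> t * u + (1 - t) * v < a.
Proof.
move=> t0 t1 hu hv; have [->|tn0] := eqVneq t 0; first by lra.
have tp : 0 < t by rewrite lt_def tn0.
by nra.
Qed.

Lemma Conv_lt (R : realType) (X : set 'rV[R]_2) n a :
  X `<=` [set z | dot n z < a] -> Conv X `<=` [set z | dot n z < a].
Proof.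
by apply: Conv_sub => x y t t0 t1 /= hx hy; rewrite !dotE; exact: avg_lt.
Qed.

(** Strictly below q for the functional m, ties being broken by n.  Such
    lexicographic half-planes are convex; they replace the open half-plane of a
    functional m + eps n with a small unspecified eps > 0. *)
Definition lex_lt (R : realType) (m n : 'rV[R]_2) (z q : 'rV[R]_2) : Prop :=
  dot m z < dot m q \/ dot m z = dot m q /\ dot n z < dot n q.

Lemma notin_Conv_lex (R : realType) (X : set 'rV[R]_2) (m n q : 'rV[R]_2) :
  X `<=` [set z | lex_lt m n z q] -> ~ Conv X q.
Proof.
move=> hX hq.
have /(_ q hq) : Conv X `<=` [set z | lex_lt m n z q]; last first.
  by case=> [|[_]]; rewrite ltxx.
apply: Conv_sub hX => x y t t0 t1 [hx|[hx hx']] [hy|[hy hy']]; rewrite /lex_lt /= !dotE.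
- by left; exact: avg_lt.
- have [->|tn0] := eqVneq t 0; first by right; split; lra.
  have tp : 0 < t by rewrite lt_def tn0.
  by left; nra.
- have [->|tn1] := eqVneq t 1; first by right; split; lra.
  have tp : t < 1 by rewrite lt_def eq_sym tn1.
  by left; nra.
- by right; split; [rewrite hx hy; ring|exact: avg_lt].
Qed.

(** Otherwise X, and with it its hull, would lie in the open half-plane where
    n is less than its value at p. *)
Lemma Conv_attains (R : realType) (X : set 'rV[R]_2) n p : Conv X p ->
  exists2 z, X z & dot n p <= dot n z.
Proof.
move=> hp; apply: contrapT => h.
suff : dot n p < dot n p by rewrite ltxx.
apply: Conv_lt hp => z Xz /=; rewrite ltNge; apply/negP => le.
by apply: h; exists z.
Qed.

Lemma continuous_dot_sub (R : realType) (p : 'rV[R]_2) :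
  continuous (fun z : 'rV[R]_2 => dot (z - p) (z - p)).
Proof.
have c i : continuous (fun z : 'rV[R]_2 => z ord0 i - p ord0 i).
  move=> z; apply: continuousB; first exact: (@coord_continuous R 1 2 ord0 i).
  exact: cst_continuous.
have cM i : continuous
    (fun z : 'rV[R]_2 => (z ord0 i - p ord0 i) * (z ord0 i - p ord0 i)).
  by move=> z; exact: (@continuousM R _ _ _ z (c i z) (c i z)).
have -> : (fun z : 'rV[R]_2 => dot (z - p) (z - p)) =
  (fun z => (z ord0 0 - p ord0 0) * (z ord0 0 - p ord0 0) +
            (z ord0 1 - p ord0 1) * (z ord0 1 - p ord0 1)).
  by apply/funext => t; rewrite /dot !mxE.
by move=> z; exact: (@continuousD R R^o _ _ _ z (cM 0 z) (cM 1 z)).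
Qed.

Lemma continuous_dot (R : realType) (n : 'rV[R]_2) : continuous (dot n).
Proof.
have c i : continuous (fun z : 'rV[R]_2 => n ord0 i * z ord0 i).
  move=> z; exact: (@continuousM R _ _ _ z (@cst_continuous _ _ _ z)
    (@coord_continuous R 1 2 ord0 i z)).
by move=> z; exact: (@continuousD R R^o _ _ _ z (c 0 z) (c 1 z)).
Qed.

Lemma dotNN (R : realType) (d : 'rV[R]_2) : dot (- d) (- d) = dot d d.
Proof. by rewrite /dot !mxE; ring. Qed.

Lemma sqr_dist_line (R : realType) (d e : 'rV[R]_2) t :
  dot (t *: e - d) (t *: e - d) =
  t * (t * dot e e) - t * (2 * dot d e) + dot d d.
Proof. by rewrite /dot !mxE; ring. Qed.

(** The functional is the difference of p and its nearest point q in K: moving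
    from q towards a point z of K with n.z >= n.p would come closer to p. *)
Lemma separation (R : realType) (K : set 'rV[R]_2) p :
  K !=set0 -> compact K -> @convex_set R 'rV[R]_2 K -> ~ K p ->
  exists2 n, n != 0 & forall z, K z -> dot n z < dot n p.
Proof.
move=> K0 cK /convexP xK Kp.
have [q Kq qmin] := EVT_min_rV K0 cK
  (continuous_subspaceT (@continuous_dot_sub _ p)).
rewrite inE in Kq.
have n0 : p - q != 0.
  by rewrite subr_eq0; apply: contra_notN Kp => /eqP ->.
exists (p - q) => // z Kz; rewrite ltNge; apply/negP => le.
have d0 := dot_gt0 n0.
set d := p - q in n0 le d0 *; set e := z - q.
have de : dot d d <= dot d e.
  by rewrite /e dotBr; move: le; rewrite {2}/d dotBr; lra.
have key t : 0 <= t -> t <= 1 -> 2 * dot d e <= t * dot e e \/ t = 0.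
  move=> t0 t1; have [->|tn0] := eqVneq t 0; first by right.
  left; have tp : 0 < t by rewrite lt_def tn0.
  have := qmin (t *: z + (1 - t) *: q); rewrite inE => /(_ (xK _ _ _ t0 t1 Kz Kq)).
  have -> : t *: z + (1 - t) *: q - p = t *: e - d.
    by apply: vecP; rewrite !mxE; ring.
  have -> : q - p = - d by rewrite opprB.
  by rewrite sqr_dist_line dotNN => h; rewrite -(ler_pM2l tp); nra.
have e0 := dot_ge0 e.
have ep : 0 < dot e e.
  have [|/eqP] := key 1 ler01 (lexx _); last by rewrite oner_eq0.
  by lra.
(* the minimizer on the line through q and z, truncated to the segment *)
have [] := key (Num.min 1 (dot d e / dot e e)).
- by rewrite le_min ler01 divr_ge0 //; lra.
- by rewrite ge_min lexx.
- have : Num.min 1 (dot d e / dot e e) * dot e e <= dot d e.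
    by rewrite -ler_pdivlMr // ge_min lexx orbT.
  by lra.
- move=> /eqP; rewrite eq_le => /andP[+ _].
  by rewrite ge_min ler10 /= leNgt divr_gt0 //; lra.
Qed.

Lemma argmax (R : realType) (K : set 'rV[R]_2) n : K !=set0 -> compact K ->
  exists2 q, K q & forall z, K z -> dot n z <= dot n q.
Proof.
move=> K0 cK.
have [q] := EVT_max_rV K0 cK (continuous_subspaceT (@continuous_dot _ n)).
rewrite inE => Kq h; exists q => // z Kz; by apply: h; rewrite inE.
Qed.

Lemma ltM (R : realType) (a x y : R) : 0 < a -> x < y -> a * x < a * y.
Proof. by move=> a0; rewrite ltr_pM2l. Qed.

Lemma leM (R : realType) (a x y : R) : 0 < a -> x <= y -> a * x <= a * y.
Proof. by move=> a0; rewrite ler_pM2l. Qed.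

Lemma ltM_inv (R : realType) (a x y : R) : 0 < a -> a * x < a * y -> x < y.
Proof. by move=> a0; rewrite ltr_pM2l. Qed.

(** * A triangle that refutes the hull property *)

(** In direction n, the set P reaches strictly beyond Q, and q is a point of P
    where it reaches furthest. *)
Definition sticks_out (R : realType) (P Q : set 'rV[R]_2) (n q : 'rV[R]_2) : Prop :=
  [/\ P q, forall z, P z -> dot n z <= dot n q & forall z, Q z -> dot n z < dot n q].

(** Here A1, A2, A0 are the vertices of the triangle whose sides support P and
    Q with normals x, y (meeting at A1), y, s (at A2) and s, x (at A0).  The
    cone conditions say that w lies between s and x, and u between y and s,
    so that P and Q stick out alternately along w, x, y, u.  The point qx of P
    lies strictly between A0 and A1 on its side: at A1 it would meet the
    direction y, where Q is ahead, and at A0 the direction w, where Q is ahead as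
    well.  Hence qx is lexicographically beyond A1 when x is tilted towards s, and
    beyond A0 when x is tilted towards y, while Q and A2 are strictly
    below the side.  In direction w the other two vertices are dominated by
    points of P or Q on the opposite sides.  The three remaining non-inclusions
    follow by exchanging the roles of P and Q, x and y, w and u, A0 and A2. *)
Lemma sticking_points_notin_Conv (R : realType) (P Q : set 'rV[R]_2)
    (x y s w u qx qy qs qw qu A0 A1 A2 : 'rV[R]_2)
    (a b c al be ga de : R) :
  0 < a -> 0 < b -> 0 < c -> a *: x + b *: y + c *: s = 0 ->
  0 < al -> 0 < be -> w = al *: s + be *: x ->
  0 < ga -> 0 < de -> u = ga *: s + de *: y ->
  sticks_out P Q x qx -> sticks_out Q P y qy ->
  sticks_out Q P w qw -> sticks_out P Q u qu ->
  (P `|` Q) qs -> (forall z, (P `|` Q) z -> dot s z <= dot s qs) ->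
  dot x A1 = dot x qx -> dot y A1 = dot y qy ->
  dot s A0 = dot s qs -> dot x A0 = dot x qx ->
  dot s A2 = dot s qs -> dot y A2 = dot y qy ->
  [/\ ~ Conv (Q `|` [set A1; A2]) qx,
      ~ Conv (Q `|` [set A0; A2]) qx &
      ~ Conv (P `|` [set A1; A2]) qw].
Proof.
move=> a0 b0 c0 rel al0 be0 wE ga0 de0 uE.
move=> [Pqx xP xQ] [Qqy yQ yP] [Qqw wQ wP] [Pqu uP uQ] PQqs sPQ.
move=> xA1 yA1 sA0 xA0 sA2 yA2.
have relz z : a * dot x z + b * dot y z + c * dot s z = 0.
  by rewrite -!dotZl -!dotDl rel dot0l.
have wz z : dot w z = al * dot s z + be * dot x z by rewrite wE !dotE.
have uz z : dot u z = ga * dot s z + de * dot y z by rewrite uE !dotE.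
(* the triangle is not reduced to a point, because Q does not reach side x *)
have xA2 : dot x A2 < dot x qx.
  have := relz A2; have := relz qy; rewrite sA2 yA2 => h1 h2.
  have h3 := xQ _ Qqy; have h4 := sPQ qy (or_intror Qqy).
  by apply: (ltM_inv a0); have := ltM a0 h3; have := leM c0 h4; lra.
have sA1 : dot s A1 < dot s qx.
  have := relz A1; have := relz qx; rewrite xA1 yA1 => h1 h2.
  by apply: (ltM_inv c0); have := ltM b0 (yP _ Pqx); lra.
(* otherwise qx = A0, and P would reach at least as far as Q along w *)
have sqx : dot s qx < dot s qs.
  rewrite ltNge; apply/negP => h.
  have := wP _ Pqx; rewrite !wz => h1.
  have h2 := xQ _ Qqw; have h3 := sPQ qw (or_intror Qqw).
  by have := leM al0 h; have := ltM be0 h2; have := leM al0 h3; lra.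
have yA0 : dot y A0 < dot y qx.
  have := relz A0; have := relz qx; rewrite xA0 sA0 => h1 h2.
  by apply: (ltM_inv b0); have := ltM c0 sqx; lra.
have wA1 : dot w A1 < dot w qw.
  apply: lt_trans (wP _ Pqx); rewrite !wz xA1.
  by rewrite ltrD2r ltr_pM2l.
have wA2 : dot w A2 < dot w qw.
  have ys : dot y qs <= dot y qy.
    by case: PQqs => [/yP/ltW|/yQ].
  have yA2s : a * (dot x qs - dot x A2) = b * (dot y qy - dot y qs).
    by have := relz A2; have := relz qs; rewrite sA2 yA2; lra.
  have wA2s : dot w qs - dot w A2 = be * (dot x qs - dot x A2).
    by rewrite !wz sA2; ring.
  have xs : 0 <= dot x qs - dot x A2.
    by rewrite -(pmulr_rge0 _ a0) yA2s pmulr_rge0 // subr_ge0.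
  have ws : dot w A2 <= dot w qs.
    by rewrite -subr_ge0 wA2s pmulr_rge0.
  case: PQqs => [Pqs|Qqs]; first exact: le_lt_trans ws (wP _ Pqs).
  have [ys'|] := ltP (dot y qs) (dot y qy).
    apply: lt_le_trans (wQ _ Qqs); rewrite -subr_gt0 wA2s pmulr_rgt0 //.
    by rewrite -(pmulr_rgt0 _ a0) yA2s pmulr_rgt0 // subr_gt0.
  (* otherwise qs is the vertex A2, and Q would reach at least as far as P
     along u *)
  move=> /(leM de0) yqs; have := uQ _ Qqs; rewrite !uz => h1.
  have := ltM de0 (yP _ Pqu).
  by have := leM ga0 (sPQ qu (or_introl Pqu)); lra.
split.
- apply: (@notin_Conv_lex _ _ x s) => z [/xQ|[|]->]; first by left.
  + by right.
  + by left.
- apply: (@notin_Conv_lex _ _ x y) => z [/xQ|[|]->]; first by left.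
  + by right.
  + by left.
- by apply: (@notin_Conv_lex _ _ w w) => z [/wP|[|]->]; left.
Qed.

Definition vertices (R : realType) (A0 A1 A2 : 'rV[R]_2) (i : 'I_3) : 'rV[R]_2 :=
  if i == 0 then A0 else if i == 1 then A1 else A2.

Lemma ord3_cases (P : 'I_3 -> Prop) : P 0 -> P 1 -> P 2 -> forall i, P i.
Proof.
move=> P0 P1 P2 [[|[|[|//]]] i3].
- by have -> : Ordinal i3 = 0 by exact: val_inj.
- by have -> : Ordinal i3 = 1 by exact: val_inj.
- by have -> : Ordinal i3 = 2 by exact: val_inj.
Qed.

(** Removing a vertex leaves a subset of the other two points, possibly
    a proper one if the vertices are not distinct; for refutations the larger set with
    both points is the convenient one. *)
Lemma one_in_hull_vertices (R : realType) (P Q : set 'rV[R]_2) (A0 A1 A2 : 'rV[R]_2) :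
  one_in_hull_of_other P Q (vertices A0 A1 A2) ->
  exists k : bool, let K := if k then Q else P in let K' := if k then P else Q in
  [\/ K' `<=` Conv (K `|` [set A1; A2]),
      K' `<=` Conv (K `|` [set A0; A2]) |
      K' `<=` Conv (K `|` [set A0; A1])].
Proof.
have mono (X Y : set 'rV[R]_2) : X `<=` Y -> Conv X `<=` Conv Y.
  by move=> XY; apply: Conv_sub; [exact: Conv_convex|move=> z /XY; exact: sub_Conv].
move=> [j [k h]]; exists k => /=.
have {}h : (if k then P else Q) `<=`
    Conv ((if k then Q else P) `|`
          (range (vertices A0 A1 A2) `\` [set vertices A0 A1 A2 j])).
  by case: k h.
elim/ord3_cases : j h => h; [apply: Or31|apply: Or32|apply: Or33];
  apply: subset_trans h _; apply: mono => z [|[[i _ <-]]]; try by left.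
all: by elim/ord3_cases : i => /= i0; right; rewrite /= /vertices /=; tauto.
Qed.

Lemma Conv3 (R : realType) (X : set 'rV[R]_2) (A0 A1 A2 : 'rV[R]_2) (r t u : R) :
  X A0 -> X A1 -> X A2 -> 0 <= r -> 0 <= t -> 0 <= u -> r + t + u = 1 ->
  Conv X (r *: A0 + t *: A1 + u *: A2).
Proof.
move=> h0 h1 h2 r0 t0 u0 rtu.
have [r1|rn1] := eqVneq r 1.
  have -> : t = 0 by lra.
  have -> : u = 0 by lra.
  by rewrite r1 !scale0r !addr0 scale1r; exact: sub_Conv.
have r1 : 0 < 1 - r.
  by rewrite subr_gt0 lt_def eq_sym rn1; lra.
have -> : r *: A0 + t *: A1 + u *: A2 = r *: A0 +
   (1 - r) *: (t / (1 - r) *: A1 + (1 - t / (1 - r)) *: A2).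
  rewrite -addrA; congr (_ + _); rewrite scalerDr !scalerA.
  have uE : u = 1 - r - t by lra.
  by congr (_ *: _ + _ *: _); rewrite ?uE; field; rewrite gt_eqF.
have tr : 0 <= t / (1 - r) by rewrite divr_ge0 //; lra.
have tr1 : t / (1 - r) <= 1 by rewrite ler_pdivrMr //; lra.
apply: Conv_convex => //; [lra|exact: sub_Conv|].
by apply: Conv_convex => //; exact: sub_Conv.
Qed.

(** The barycentric coordinates of z are its distances to the three sides,
    weighted by the coefficients of the relation between the normals; the
    assumption that the weighted offsets have a positive sum says that the
    triangle has nonempty interior. *)
Lemma in_triangle (R : realType) (x y s A0 A1 A2 z : 'rV[R]_2)
    (a b c X Y S : R) :
  cross x y != 0 -> 0 < a -> 0 < b -> 0 < c ->
  a *: x + b *: y + c *: s = 0 -> 0 < a * X + b * Y + c * S ->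
  dot x A1 = X -> dot y A1 = Y ->
  dot s A0 = S -> dot x A0 = X ->
  dot s A2 = S -> dot y A2 = Y ->
  dot x z <= X -> dot y z <= Y -> dot s z <= S ->
  Conv (range (vertices A0 A1 A2)) z.
Proof.
move=> xy a0 b0 c0 rel; set L := _ + _ + _ => L0 xA1 yA1 sA0 xA0 sA2 yA2 xz yz sz.
have relz p : a * dot x p + b * dot y p + c * dot s p = 0.
  by rewrite -!dotZl -!dotDl rel dot0l.
have xA2 : a * (X - dot x A2) = L.
  by have := relz A2; rewrite sA2 yA2 /L; lra.
have yA0 : b * (Y - dot y A0) = L.
  by have := relz A0; rewrite sA0 xA0 /L; lra.
have Ln0 : L != 0 by rewrite gt_eqF.
have zE : z = (b * (Y - dot y z) / L) *: A0 + (c * (S - dot s z) / L) *: A1 +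
    (a * (X - dot x z) / L) *: A2.
  have sum1 : c * (S - dot s z) = L - b * (Y - dot y z) - a * (X - dot x z).
    by have := relz z; rewrite /L; lra.
  apply: (dot_ext xy); apply: (mulfI Ln0); rewrite !dotE.
  - rewrite xA0 xA1 sum1.
    have -> : dot x A2 = X - L / a by rewrite -xA2; field; rewrite gt_eqF.
    by field; rewrite Ln0 gt_eqF.
  - rewrite yA2 yA1 sum1.
    have -> : dot y A0 = Y - L / b by rewrite -yA0; field; rewrite gt_eqF.
    by field; rewrite Ln0 gt_eqF.
rewrite zE; apply: Conv3; [by exists 0|by exists 1|by exists 2|..].
- by rewrite divr_ge0 ?mulr_ge0 ?subr_ge0 // ltW.
- by rewrite divr_ge0 ?mulr_ge0 ?subr_ge0 // ltW.
- by rewrite divr_ge0 ?mulr_ge0 ?subr_ge0 // ltW.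
- rewrite -!mulrDl (_ : _ + _ + _ = L) ?divff //.
  by have := relz z; rewrite /L; lra.
Qed.

(** Four alternating signs yield a counterexample triangle: all six
    inclusions fail for the triangle of the supporting sides x, y and s. *)
Lemma triangle_refutes (R : realType) (P Q : set 'rV[R]_2)
    (x y s w u qx qy qs qw qu : 'rV[R]_2) (a b c al be ga de : R) :
  cross x y != 0 ->
  0 < a -> 0 < b -> 0 < c -> a *: x + b *: y + c *: s = 0 ->
  0 < al -> 0 < be -> w = al *: s + be *: x ->
  0 < ga -> 0 < de -> u = ga *: s + de *: y ->
  sticks_out P Q x qx -> sticks_out Q P y qy ->
  sticks_out Q P w qw -> sticks_out P Q u qu ->
  (P `|` Q) qs -> (forall z, (P `|` Q) z -> dot s z <= dot s qs) ->
  exists A : 'I_3 -> 'rV[R]_2, [/\ P `<=` Conv (range A), Q `<=` Conv (range A) &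
    ~ one_in_hull_of_other P Q A].
Proof.
move=> xy a0 b0 c0 rel al0 be0 wE ga0 de0 uE hx hy hw hu PQqs sPQ.
have csx : c * cross s x = b * cross x y.
  transitivity (cross (a *: x + b *: y + c *: s) x + b * cross x y).
    by rewrite /cross !mxE; ring.
  by rewrite rel /cross !mxE; ring.
have csy : c * cross s y = - a * cross x y.
  transitivity (cross (a *: x + b *: y + c *: s) y - a * cross x y).
    by rewrite /cross !mxE; ring.
  by rewrite rel /cross !mxE; ring.
have sx : cross s x != 0.
  by apply: contra_neq xy => h; apply/eqP; move: csx; rewrite h mulr0 => /esym/eqP;
     rewrite mulf_eq0 gt_eqF.
have sy : cross s y != 0.
  apply: contra_neq xy => h; apply/eqP; move: csy; rewrite h mulr0 => /esym/eqP.
  by rewrite mulf_eq0 oppr_eq0 gt_eqF.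
have [A1 [xA1 yA1]] := dot_solve (dot x qx) (dot y qy) xy.
have [A0 [sA0 xA0]] := dot_solve (dot s qs) (dot x qx) sx.
have [A2 [sA2 yA2]] := dot_solve (dot s qs) (dot y qy) sy.
exists (vertices A0 A1 A2).
have inT z : (P `|` Q) z -> Conv (range (vertices A0 A1 A2)) z.
  case: (hx) (hy) => [Pqx xP xQ] [Qqy yQ yP] hz.
  apply: (in_triangle xy a0 b0 c0 rel _ xA1 yA1 sA0 xA0 sA2 yA2).
  - have : a * dot x qy + b * dot y qy + c * dot s qy = 0.
      by rewrite -!dotZl -!dotDl rel dot0l.
    have := ltM a0 (xQ _ Qqy).
    by have := leM c0 (sPQ qy (or_intror Qqy)); lra.
  - by case: hz => [/xP|/xQ/ltW].
  - by case: hz => [/yP/ltW|/yQ].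
  - exact: sPQ.
split; [by move=> z Pz; apply: inT; left|by move=> z Qz; apply: inT; right|].
have [h1 h2 h3] := sticking_points_notin_Conv a0 b0 c0 rel al0 be0 wE ga0 de0 uE
  hx hy hw hu PQqs sPQ xA1 yA1 sA0 xA0 sA2 yA2.
have [h4 h5 h6] : [/\ ~ Conv (P `|` [set A1; A0]) qy,
    ~ Conv (P `|` [set A2; A0]) qy & ~ Conv (Q `|` [set A1; A0]) qu].
  apply: (sticking_points_notin_Conv b0 a0 c0 _ ga0 de0 uE al0 be0 wE hy hx hu hw
    _ _ yA1 xA1 sA2 yA2 sA0 xA0).
  - by rewrite [b *: y + _]addrC.
  - by rewrite setUC.
  - by rewrite setUC.
case: hx hy hw hu => [Pqx _ _] [Qqy _ _] [Qqw _ _] [Pqu _ _].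
move=> /one_in_hull_vertices [[|] /=] [] h.
- by apply: h1; exact: h.
- by apply: h2; exact: h.
- by apply: h6; rewrite [[set _; _]]setUC; exact: h.
- by apply: h3; exact: h.
- by apply: h5; rewrite [[set _; _]]setUC; exact: h.
- by apply: h4; rewrite [[set _; _]]setUC; exact: h.
Qed.

(** * Discs and mirrors *)

Lemma polar (R : realType) (v : 'rV[R]_2) :
  exists2 e : 'rV[R]_2, dot e e = 1 & v = Num.sqrt (dot v v) *: e.
Proof.
have [->|v0] := eqVneq v 0.
  exists (vec 1 0); first by rewrite /dot vec0 vec1; ring.
  by rewrite dot0l sqrtr0 scale0r.
have s0 : 0 < Num.sqrt (dot v v) by rewrite sqrtr_gt0 dot_gt0.
exists ((Num.sqrt (dot v v))^-1 *: v).
  by rewrite dotZl dotZr mulrA -expr2 exprVn sqr_sqrtr ?dot_ge0 // mulVf // gt_eqF ?dot_gt0.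
by rewrite scalerA divff ?scale1r // gt_eqF.
Qed.

(** The round form of [Conv (circle c r)], see [Conv_circle]. *)
Definition disc (R : realType) (c : 'rV[R]_2) (r : R) : set 'rV[R]_2 :=
  [set z | Num.sqrt (dot (z - c) (z - c)) <= r].

(** Every point of the disc lies on a diameter, whose endpoints are on the
    circle. *)
Lemma Conv_circle (R : realType) (c : 'rV[R]_2) (r : R) :
  0 <= r -> Conv (circle c r) = disc c r.
Proof.
move=> r0; apply/seteqP; split.
  apply: Conv_sub => [x y t t0 t1|z]; rewrite /disc /circle /= ?edistE; last by move->.
  move=> hx hy.
  have [e e1 eE] := polar (t *: x + (1 - t) *: y - c).
  have -> : Num.sqrt (dot (t *: x + (1 - t) *: y - c) (t *: x + (1 - t) *: y - c)) =
      t * dot e (x - c) + (1 - t) * dot e (y - c).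
    transitivity (dot e (t *: x + (1 - t) *: y - c)).
      by rewrite [in RHS]eE dotZr e1 mulr1.
    by rewrite !dotE; ring.
  have b z : Num.sqrt (dot (z - c) (z - c)) <= r -> dot e (z - c) <= r.
    by apply: le_trans; have := dot_le_norm e (z - c); rewrite e1 sqrtr1 mul1r.
  have t1' : 0 <= 1 - t by rewrite subr_ge0.
  by have := ler_wpM2l t0 (b _ hx); have := ler_wpM2l t1' (b _ hy); lra.
move=> z; rewrite /disc /=.
have [e e1] := polar (z - c); set d := Num.sqrt _ => eE dr.
have d0 : 0 <= d by exact: sqrtr_ge0.
have zE : z = c + d *: e by rewrite -eE addrC subrK.
have onC k : k ^+ 2 = r ^+ 2 -> Conv (circle c r) (c + k *: e).
  move=> kr; apply: sub_Conv; rewrite /circle /= edistE.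
  by rewrite addrC addKr dotZl dotZr e1 mulr1 -expr2 kr sqrtr_sqr ger0_norm.
have [r00|rn0] := eqVneq r 0.
  by rewrite zE; apply: onC; have -> : d = r by lra.
have rp : 0 < r by rewrite lt_def rn0.
have t0 : 0 <= (1 + d / r) / 2 by rewrite divr_ge0 // addr_ge0 // divr_ge0.
have dr1 : d / r <= 1 by rewrite ler_pdivrMr // mul1r.
have -> : z = (1 + d / r) / 2 *: (c + r *: e) + (1 - (1 + d / r) / 2) *: (c + (- r) *: e).
  by rewrite zE; apply: vecP; rewrite !mxE; field.
apply: Conv_convex => //; first by lra.
  exact: onC.
by apply: onC; rewrite sqrrN.
Qed.

(** The reflection in the line spanned by the vector a, for a of length 1. *)
Definition mirror (R : realType) (a z : 'rV[R]_2) : 'rV[R]_2 := (2 * dot a z) *: a - z.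

Definition perp (R : realType) (a : 'rV[R]_2) : 'rV[R]_2 := vec (- a ord0 1) (a ord0 0).

Lemma dot_perp (R : realType) (a n : 'rV[R]_2) : dot n (perp a) = cross a n.
Proof. by rewrite /dot /perp /cross vec0 vec1; ring. Qed.

Lemma unit_expand (R : realType) (a n : 'rV[R]_2) : dot a a = 1 ->
  n = dot a n *: a + cross a n *: perp a.
Proof.
move=> a1; apply: vecP; rewrite !mxE /= -[LHS]mul1r -a1 /dot /cross; ring.
Qed.

Lemma dot_mirror (R : realType) (a n z : 'rV[R]_2) : dot n (mirror a z) = dot (mirror a n) z.
Proof. by rewrite /mirror /dot !mxE; ring. Qed.

Lemma mirrorK (R : realType) (a z : 'rV[R]_2) : dot a a = 1 -> mirror a (mirror a z) = z.
Proof.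
move=> a1; rewrite /mirror dotBr dotZr a1 mulr1.
by apply: vecP; rewrite !mxE; ring.
Qed.

Lemma cross_mirror (R : realType) (a z : 'rV[R]_2) : cross a (mirror a z) = - cross a z.
Proof. by rewrite /cross /mirror !mxE; ring. Qed.

Lemma mirror_isometry (R : realType) (a v : 'rV[R]_2) : dot a a = 1 ->
  is_isometry (fun z => mirror a z + v).
Proof.
move=> a1 x y; rewrite !edistE; congr Num.sqrt.
have -> : mirror a x + v - (mirror a y + v) = mirror a (x - y).
  by rewrite /mirror; apply: vecP; rewrite /dot !mxE; ring.
by rewrite dot_mirror mirrorK.
Qed.

(** The support function of K, as a relation because it is only needed for
    compact sets, where the supremum is attained. *)
Definition is_support (R : realType) (K : set 'rV[R]_2) (h : 'rV[R]_2 -> R) :=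
  forall n, (exists2 q, K q & dot n q = h n) /\ forall z, K z -> dot n z <= h n.

Lemma exists_support (R : realType) (K : set 'rV[R]_2) : K !=set0 -> compact K ->
  exists h, is_support K h.
Proof.
move=> K0 cK.
have /choice[q hq] : forall n, exists q, K q /\ forall z, K z -> dot n z <= dot n q.
  by move=> n; have [q Kq qmax] := argmax n K0 cK; exists q.
exists (fun n => dot n (q n)) => n; have [Kq qmax] := hq n.
by split=> //; exists (q n).
Qed.

Lemma support_sticks_out (R : realType) (P Q : set 'rV[R]_2) hP hQ n :
  is_support P hP -> is_support Q hQ -> hQ n < hP n -> exists q, sticks_out P Q n q.
Proof.
move=> /(_ n) [[q Pq qE] hPn] /(_ n) [_ hQn] lt; exists q; rewrite /sticks_out qE.
by split=> // z /hQn /le_lt_trans; exact.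
Qed.

Lemma support_mirror (R : realType) (K : set 'rV[R]_2) h (a : 'rV[R]_2) (c : R) :
  is_support K h ->
  is_support ((fun z => mirror a z + c *: perp a) @` K)
             (fun n => h (mirror a n) + c * cross a n).
Proof.
move=> hK n; have [[q Kq qE] hn] := hK (mirror a n).
have E z : dot n (mirror a z + c *: perp a) = dot (mirror a n) z + c * cross a n.
  by rewrite dotDr dotZr dot_perp dot_mirror.
split; first by exists (mirror a q + c *: perp a); [exists q|rewrite E qE].
by move=> _ [z Kz <-]; rewrite E lerD2r; exact: hn.
Qed.

Lemma one_in_hullC (R : realType) (P Q : set 'rV[R]_2) A :
  one_in_hull_of_other P Q A -> one_in_hull_of_other Q P A.
Proof. by move=> [j [k h]]; exists j, (~~ k); case: k h. Qed.

(** Take x = mirror n1, y = n1, u = n2, w = mirror n2 and s = - a: since the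
    mirror fixes a, the triangle is isosceles with axis of direction a, and
    the cone condition on w is the mirror image of that on u. *)
Lemma mirror_normals_refute (R : realType) (P Q : set 'rV[R]_2) hP hQ
    (a n1 n2 : 'rV[R]_2) :
  is_support P hP -> is_support Q hQ -> dot a a = 1 ->
  0 < dot a n1 -> 0 < cross a n1 -> 0 < cross n1 n2 -> 0 < cross a n2 ->
  hP n1 < hQ n1 -> hQ n2 < hP n2 ->
  hQ (mirror a n1) < hP (mirror a n1) -> hP (mirror a n2) < hQ (mirror a n2) ->
  exists A : 'I_3 -> 'rV[R]_2, [/\ P `<=` Conv (range A), Q `<=` Conv (range A) &
    ~ one_in_hull_of_other P Q A].
Proof.
move=> sP sQ a1 an1 k1 n12 k2 h1 h2 h3 h4.
have [qy hy] := support_sticks_out sQ sP h1.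
have [qu hu] := support_sticks_out sP sQ h2.
have [qx hx] := support_sticks_out sP sQ h3.
have [qw hw] := support_sticks_out sQ sP h4.
have [qs PQqs qsmax] : exists2 qs, (P `|` Q) qs &
    forall z, (P `|` Q) z -> dot (- a) z <= dot (- a) qs.
  have [[p Pp pE] hp] := sP (- a); have [[q Qq qE] hq] := sQ (- a).
  have [le|/ltW le] := leP (hP (- a)) (hQ (- a));
    [exists q; first by right|exists p; first by left].
  - by move=> z [/hp|/hq]; rewrite qE // => /le_trans; exact.
  - by move=> z [/hp|/hq]; rewrite pE // => /le_trans; exact.
have k1n : cross a n1 != 0 by rewrite gt_eqF.
have n2E : n2 = (cross n1 n2 / cross a n1) *: (- a) + (cross a n2 / cross a n1) *: n1.
  have eK k : cross a n1 * (k / cross a n1) = k by field.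
  apply: (scalerI k1n); rewrite scalerDr !scalerA !eK.
  by apply: vecP; rewrite /cross !mxE; ring.
have ga0 : 0 < cross n1 n2 / cross a n1 by rewrite divr_gt0.
have de0 : 0 < cross a n2 / cross a n1 by rewrite divr_gt0.
have c0 : 0 < 2 * dot a n1 by rewrite mulr_gt0.
apply: (@triangle_refutes _ P Q (mirror a n1) n1 (- a) (mirror a n2) n2
  qx qy qs qw qu 1 1 (2 * dot a n1) _ _ _ _ _ _ _ _ _ ga0 de0 _ ga0 de0 n2E) => //.
- rewrite (_ : cross _ _ = 2 * dot a n1 * cross a n1); first by rewrite gt_eqF ?mulr_gt0.
  by rewrite /mirror /cross !mxE; ring.
- by rewrite /mirror; apply: vecP; rewrite !mxE; ring.
- rewrite [in LHS]n2E; move: (_ / _) (_ / _) => d g.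
  have -> : mirror a (g *: - a + d *: n1) = g *: mirror a (- a) + d *: mirror a n1.
    by rewrite /mirror; apply: vecP; rewrite /dot !mxE; ring.
  congr (_ *: _ + _); rewrite /mirror -scaleN1r dotZr a1.
  by apply: vecP; rewrite !mxE; ring.
Qed.

Definition isometric_hull_property (R : realType) (K0 : set 'rV[R]_2) : Prop :=
  forall (K1 : set 'rV[R]_2) (A : 'I_3 -> 'rV[R]_2),
    are_isometric K0 K1 ->
    K0 `<=` Conv (range A) -> K1 `<=` Conv (range A) ->
    one_in_hull_of_other K0 K1 A.

(** If the two quotients differ, the opposite of their mean is the translation
    c for which the support functions of K0 and of its translated mirror image
    differ with opposite signs at n1 and n2; by antisymmetry the mirror images
    of n1 and n2 supply two more sign changes. *)
Lemma axis_defect_ratio (R : realType) (K0 : set 'rV[R]_2) h (a n1 n2 : 'rV[R]_2) :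
  isometric_hull_property K0 ->
  is_support K0 h -> dot a a = 1 ->
  0 < dot a n1 -> 0 < cross a n1 -> 0 < cross n1 n2 -> 0 < cross a n2 ->
  (h (mirror a n1) - h n1) / cross a n1 = (h (mirror a n2) - h n2) / cross a n2.
Proof.
move=> H sK a1 an1 k1 n12 k2; apply/eqP; apply: contrapT => /negP.
set F1 := (X in X == _); set F2 := (X in _ == X) => neq.
have E1 : h (mirror a n1) - h n1 = F1 * cross a n1 by rewrite /F1 mulfVK // gt_eqF.
have E2 : h (mirror a n2) - h n2 = F2 * cross a n2 by rewrite /F2 mulfVK // gt_eqF.
pose c := - (F1 + F2) / 2.
pose K1 := (fun z => mirror a z + c *: perp a) @` K0.
have sK1 := support_mirror a c sK.
have iso : are_isometric K0 K1.
  by exists (fun z => mirror a z + c *: perp a) => //; exact: mirror_isometry.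
have D1 : h (mirror a n1) + c * cross a n1 - h n1 = (F1 - F2) / 2 * cross a n1.
  by rewrite /c addrAC E1; field.
have D2 : h (mirror a n2) + c * cross a n2 - h n2 = (F2 - F1) / 2 * cross a n2.
  by rewrite /c addrAC E2; field.
have [lt|lt] : F1 < F2 \/ F2 < F1 by apply/orP; rewrite -neq_lt.
- have p1 : (F1 - F2) / 2 * cross a n1 < 0 by rewrite pmulr_llt0 //; lra.
  have p2 : 0 < (F2 - F1) / 2 * cross a n2 by rewrite mulr_gt0 //; lra.
  have [||||A [h1 h0]] := mirror_normals_refute sK1 sK a1 an1 k1 n12 k2;
    rewrite ?mirrorK // ?cross_mirror; try lra.
  by apply; apply: one_in_hullC; exact: H.
- have p1 : 0 < (F1 - F2) / 2 * cross a n1 by rewrite mulr_gt0 //; lra.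
  have p2 : (F2 - F1) / 2 * cross a n2 < 0 by rewrite pmulr_llt0 //; lra.
  have [||||A [h0 h1]] := mirror_normals_refute sK sK1 a1 an1 k1 n12 k2;
    rewrite ?mirrorK // ?cross_mirror; try lra.
  by apply; exact: H.
Qed.

(** A constant quotient says that K0 is symmetric in an axis of direction a,
    whose position is determined by c.  To compare an arbitrary n above the axis
    with [perp a], both are compared with a vector n1 = a + e a' so close to a
    that it precedes them, where a' is [perp a]. *)
Lemma axis_defect (R : realType) (K0 : set 'rV[R]_2) h (a : 'rV[R]_2) :
  isometric_hull_property K0 ->
  is_support K0 h -> dot a a = 1 ->
  exists c, forall n, h (mirror a n) - h n = c * cross a n.
Proof.
move=> H sK a1; exists (h (mirror a (perp a)) - h (perp a)).
have kp : cross a (perp a) = 1.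
  rewrite -a1 /cross /perp vec0 vec1 /dot. ring.
have ap : dot a (perp a) = 0 by rewrite /dot /perp vec0 vec1; ring.
have up n : 0 < cross a n ->
    h (mirror a n) - h n = (h (mirror a (perp a)) - h (perp a)) * cross a n.
  move=> k0.
  have d0 : 0 < 1 + `|dot a n| by rewrite addrC ltr_wpDl.
  pose e := cross a n / (1 + `|dot a n|).
  have e0 : 0 < e by rewrite divr_gt0.
  have an1 : 0 < dot a (a + e *: perp a) by rewrite dotDr dotZr ap a1; lra.
  have k1 : 0 < cross a (a + e *: perp a).
    have -> : cross a (a + e *: perp a) = e * cross a (perp a).
      by rewrite /cross !mxE; ring.
    by rewrite kp mulr1.
  have n12 : 0 < cross (a + e *: perp a) n.
    rewrite (_ : cross _ _ = cross a n - e * dot a n); last first.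
      by rewrite /cross /dot /perp !mxE /=; ring.
    rewrite subr_gt0; apply: (@le_lt_trans _ _ (e * `|dot a n|)).
      by rewrite ler_pM2l // ler_norm.
    by rewrite /e mulrAC ltr_pdivrMr // ltr_pM2l // ltrDr.
  have n12' : 0 < cross (a + e *: perp a) (perp a).
    have -> : cross (a + e *: perp a) (perp a) = cross a (perp a).
      by rewrite /cross !mxE; ring.
    by rewrite kp.
  have := axis_defect_ratio H sK a1 an1 k1 n12 k0.
  rewrite (axis_defect_ratio H sK a1 an1 k1 n12') kp // divr1 => ->.
  by rewrite mulfVK // gt_eqF.
move=> n; case: (ltgtP 0 (cross a n)) => [/up //|k0|k0].
  have := up (mirror a n); rewrite cross_mirror mirrorK // oppr_gt0 => /(_ k0).
  by lra.
rewrite -k0 mulr0; suff -> : mirror a n = n by rewrite subrr.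
rewrite /mirror {2 3}(unit_expand n a1) -k0 scale0r addr0.
by apply: vecP; rewrite !mxE; ring.
Qed.

(** A compact convex set is the intersection of its support half-planes. *)
Lemma disc_of_constant_support (R : realType) (K : set 'rV[R]_2) h o r :
  K !=set0 -> compact K -> @convex_set R 'rV[R]_2 K -> is_support K h ->
  (forall n, dot n n = 1 -> h n = r + dot n o) -> 0 <= r /\ K = disc o r.
Proof.
move=> K0 cK xK sK hE.
have Kd : K `<=` disc o r.
  move=> z Kz; rewrite /disc /=; have [e e1 zE] := polar (z - o).
  have := (sK e).2 z Kz; rewrite hE // => hz.
  have : dot e (z - o) <= r by rewrite dotBr; lra.
  by rewrite {1}zE dotZr e1 mulr1.
split; first by case: K0 => z /Kd; apply: le_trans; exact: sqrtr_ge0.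
apply/seteqP; split=> // z dz; apply: contrapT => Kz.
have [n n0 sep] := separation K0 cK xK Kz.
have [e e1 nE] := polar n.
have s0 : 0 < Num.sqrt (dot n n) by rewrite sqrtr_gt0 dot_gt0.
have [[q Kq qE] _] := sK e.
have := sep q Kq; rewrite nE !dotZl ltr_pM2l // qE hE // => lt.
have := dot_le_norm e (z - o); rewrite e1 sqrtr1 mul1r dotBr => le.
by move: dz; rewrite /disc /= => dz; lra.
Qed.

(** With centre o given by the two coordinate axes, the function g below is
    even.  For a direction a the defect of g is a multiple of the odd function
    [cross a], so evenness makes it vanish, and g is invariant under all mirrors.
    Any two unit vectors that are not opposite are exchanged by the mirror in
    their bisector. *)
Lemma disk_of_isometric_hull_property (R : realType) (K0 : set 'rV[R]_2) :
  K0 !=set0 -> compact K0 -> @convex_set R 'rV[R]_2 K0 ->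
  isometric_hull_property K0 ->
  is_disk K0.
Proof.
move=> K0n cK xK H; have [h sK] := exists_support K0n cK.
have e1u : dot (vec 1 0) (vec 1 0) = 1 :> R by rewrite /dot !mxE /=; ring.
have e2u : dot (vec 0 1) (vec 0 1) = 1 :> R by rewrite /dot !mxE /=; ring.
have [c1 h1] := axis_defect H sK e1u; have [c2 h2] := axis_defect H sK e2u.
pose o := vec (c2 / 2) (- c1 / 2); pose g n := h n - dot n o.
have gN n : g (- n) = g n.
  have := h1 (mirror (vec 0 1) n); have := h2 n.
  have -> : mirror (vec 1 0) (mirror (vec 0 1) n) = - n.
    by apply: vecP; rewrite /mirror /dot !mxE /=; ring.
  rewrite /g /cross /mirror /dot /o !mxE /=; lra.
have g_mirror a n : dot a a = 1 -> g (mirror a n) = g n.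
  move=> a1; have [c hc] := axis_defect H sK a1.
  have gc m : g (mirror a m) - g m = (c + 2 * cross a o) * cross a m.
    have := hc m; rewrite /g (_ : dot (mirror a m) o = dot m o - 2 * cross a m * cross a o).
      by lra.
    transitivity ((2 * dot a a - 1) * dot m o - 2 * cross a m * cross a o).
      by rewrite /mirror /dot /cross !mxE; ring.
    by rewrite a1; ring.
  have := gc n; have := gc (- n).
  rewrite (_ : mirror a (- n) = - mirror a n); last first.
    by apply: vecP; rewrite /mirror /dot !mxE; ring.
  rewrite !gN (_ : cross a (- n) = - cross a n); last by rewrite /cross !mxE; ring.
  by lra.
have g_const n : dot n n = 1 -> g n = g (vec 1 0).
  move=> n1; have [nN|nN] := eqVneq (n + vec 1 0) 0.
    by rewrite -[vec 1 0]opprK gN (_ : n = - vec 1 0) //; apply/eqP; rewrite -addr_eq0 nN.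
  have [a a1 aE] := polar (n + vec 1 0).
  have s0 : 0 < dot (n + vec 1 0) (n + vec 1 0) by rewrite dot_gt0.
  rewrite -(g_mirror a n a1); congr g; rewrite /mirror.
  apply/eqP; rewrite subr_eq addrC aE; apply/eqP; congr (_ *: _).
  have t0 : Num.sqrt (dot (n + vec 1 0) (n + vec 1 0)) != 0 by rewrite gt_eqF // sqrtr_gt0.
  apply: (mulIf t0); rewrite -expr2 sqr_sqrtr ?dot_ge0 //.
  transitivity (2 * dot (n + vec 1 0) n).
    by rewrite [in RHS]aE dotZl; ring.
  by rewrite !dotE n1 e1u (dotC n); ring.
have hE n : dot n n = 1 -> h n = g (vec 1 0) + dot n o.
  by move=> /g_const <-; rewrite /g subrK.
have [r0 ->] := disc_of_constant_support K0n cK xK sK hE.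
by exists o, (g (vec 1 0)) => //; rewrite Conv_circle.
Qed.

(** * Similar discs *)

(** After division by the ratio, the images u and v of the unit vectors form an
    orthonormal frame, and the coordinates of an image in that frame are those
    of the original point; so the preimage of z can be written down. *)
Lemma similarity_surjective (R : realType) (phi : 'rV[R]_2 -> 'rV[R]_2) (k : R) :
  0 < k -> (forall x y, Defs.edist (phi x) (phi y) = k * Defs.edist x y) ->
  forall z, exists x, phi x = z.
Proof.
move=> k0 phiE z.
have sq x y : dot (phi x - phi y) (phi x - phi y) = k ^+ 2 * dot (x - y) (x - y).
  by rewrite -!edist_sqr phiE exprMn.
pose u := phi (vec 1 0) - phi 0; pose v := phi (vec 0 1) - phi 0.
have uE x : dot u (phi x - phi 0) = k ^+ 2 * x ord0 0.
  have h1 := sq (vec 1 0) 0; have h2 := sq x 0; have h3 := sq (vec 1 0) x.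
  have : 2 * dot u (phi x - phi 0) = dot u u + dot (phi x - phi 0) (phi x - phi 0)
     - dot (phi (vec 1 0) - phi x) (phi (vec 1 0) - phi x).
    by rewrite /u /dot !mxE; ring.
  by rewrite h1 h2 h3 /dot !mxE /=; lra.
have vE x : dot v (phi x - phi 0) = k ^+ 2 * x ord0 1.
  have h1 := sq (vec 0 1) 0; have h2 := sq x 0; have h3 := sq (vec 0 1) x.
  have : 2 * dot v (phi x - phi 0) = dot v v + dot (phi x - phi 0) (phi x - phi 0)
     - dot (phi (vec 0 1) - phi x) (phi (vec 0 1) - phi x).
    by rewrite /v /dot !mxE; ring.
  by rewrite h1 h2 h3 /dot !mxE /=; lra.
have k2 : k ^+ 2 != 0 by rewrite expf_neq0 // gt_eqF.
have uv : cross u v != 0.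
  rewrite -sqrf_eq0 (_ : _ ^+ 2 = dot u u * dot v v - dot u v ^+ 2); last first.
    by rewrite /dot /cross; ring.
  have -> : dot u u = k ^+ 2 by rewrite {2}/u uE vec0 mulr1.
  have -> : dot v v = k ^+ 2 by rewrite {2}/v vE vec1 mulr1.
  have -> : dot u v = 0 by rewrite {1}/v uE vec0 mulr0.
  by rewrite expr0n subr0 mulf_neq0.
exists (vec (dot u (z - phi 0) / k ^+ 2) (dot v (z - phi 0) / k ^+ 2)).
apply: (subIr (phi 0)); apply: (dot_ext uv).
- by rewrite uE vec0 mulrCA divff ?mulr1.
- by rewrite vE vec1 mulrCA divff ?mulr1.
Qed.

Lemma similar_disc (R : realType) (phi : 'rV[R]_2 -> 'rV[R]_2) (k : R) c r :
  0 < k -> (forall x y, Defs.edist (phi x) (phi y) = k * Defs.edist x y) ->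
  phi @` disc c r = disc (phi c) (k * r).
Proof.
move=> k0 phiE; rewrite /disc; apply/seteqP; split=> [_ [x + <-]|z].
  by rewrite /= -!edistE phiE ler_pM2l.
have [x <-] := similarity_surjective k0 phiE z.
by rewrite /= -!edistE phiE ler_pM2l // => h; exists x => //=; rewrite -edistE.
Qed.

Lemma disc_homothety (R : realType) (c c' : 'rV[R]_2) (k r : R) : 0 < k ->
  (fun z => c' + k *: (z - c)) @` disc c r = disc c' (k * r).
Proof.
move=> k0.
have E x y : Defs.edist (c' + k *: (x - c)) (c' + k *: (y - c)) = k * Defs.edist x y.
  rewrite !edistE (_ : _ - _ = k *: (x - y)); last by apply: vecP; rewrite !mxE; ring.
  by rewrite dotZl dotZr mulrA -expr2 sqrtrM ?sqr_ge0 // sqrtr_sqr gtr0_norm.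
by have := similar_disc c r k0 E; rewrite subrr scaler0 addr0.
Qed.

Lemma continuous_homothety (R : realType) (c c' : 'rV[R]_2) (k : R) :
  continuous (fun z : 'rV[R]_2 => c' + k *: (z - c)).
Proof.
have h1 : continuous (fun z : 'rV[R]_2 => z - c).
  move=> w; apply: (@continuousB R 'rV[R]_2 _ (fun z => z) (fun=> c) w).
    exact: (@cvg_id _ (nbhs w)).
  exact: (@cst_continuous _ _ c w).
have h2 : continuous (fun z : 'rV[R]_2 => k *: (z - c)).
  move=> w.
  exact: (@continuousZ R 'rV[R]_2 'rV[R]_2 (fun=> k)
    (fun z : 'rV[R]_2 => z - c) w (@cst_continuous _ _ k w) (h1 w)).
move=> w.
exact: (@continuousD R 'rV[R]_2 'rV[R]_2 (fun=> c')
  (fun z : 'rV[R]_2 => k *: (z - c)) w (@cst_continuous _ _ c' w) (h2 w)).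
Qed.

Lemma compact_disc_scale (R : realType) (c c' : 'rV[R]_2) (k r : R) : 0 < k ->
  compact (disc c r) -> compact (disc c' (k * r)).
Proof.
move=> k0 cD; rewrite -(disc_homothety c c' r k0); apply: continuous_compact => //.
exact/continuous_subspaceT/continuous_homothety.
Qed.

Lemma disc_dot_le (R : realType) (c n p : 'rV[R]_2) r : disc c r p ->
  dot n p <= dot n c + r * Num.sqrt (dot n n).
Proof.
rewrite /disc /= => dp; have := dot_le_norm n (p - c); rewrite dotBr.
by have := ler_wpM2l (sqrtr_ge0 (dot n n)) dp; lra.
Qed.

Lemma disc_dot_attained (R : realType) (c n : 'rV[R]_2) r : 0 <= r ->
  exists2 q, disc c r q & dot n q = dot n c + r * Num.sqrt (dot n n).
Proof.
move=> r0; have [e e1 nE] := polar n; exists (c + r *: e).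
  by rewrite /disc /= addrC addKr dotZl dotZr e1 mulr1 -expr2 sqrtr_sqr ger0_norm.
rewrite dotDr dotZr; congr (_ + _ * _).
by rewrite nE dotZl e1 mulr1 -nE.
Qed.

Lemma continuous_join (R : realType) (a : 'rV[R]_2) :
  continuous (fun p : R * 'rV[R]_2 => p.1 *: p.2 + (1 - p.1) *: a).
Proof.
move=> p.
have hf : {for p, continuous (fun p : R * 'rV[R]_2 => p.1)} by exact: cvg_fst.
have hs : {for p, continuous (fun p : R * 'rV[R]_2 => p.2)} by exact: cvg_snd.
have h1 := @continuousZ R 'rV[R]_2 _ _ _ p hf hs.
have h2 := @continuousB R R^o _ (fun=> 1) _ p (@cst_continuous _ _ _ p) hf.
have h3 := @continuousZ R 'rV[R]_2 _ _ (fun=> a) p h2 (@cst_continuous _ _ _ p).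
exact: (@continuousD R 'rV[R]_2 _ _ _ p h1 h3).
Qed.

(** * Separation from a hull with finitely many points *)

(** The union of the segments from a to the points of K.  It is all that is
    needed of the hull of K and a: compact and convex, so that [separation]
    applies, and contained in the hull. *)
Lemma join_point (R : realType) (K : set 'rV[R]_2) (a : 'rV[R]_2) :
  K !=set0 -> compact K -> @convex_set R 'rV[R]_2 K ->
  exists E : set 'rV[R]_2, [/\ compact E, @convex_set R 'rV[R]_2 E,
    K `<=` E, E a & E `<=` Conv (K `|` [set a])].
Proof.
move=> [z0 Kz0] cK /convexP xK.
pose F (p : R * 'rV[R]_2) := p.1 *: p.2 + (1 - p.1) *: a.
have seg01 t : `[0, 1]%classic t <-> 0 <= t /\ t <= (1 : R).
  by rewrite /= in_itv /=; split=> [/andP[]|[-> ->]].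
exists (F @` (`[0, 1]%classic `*` K)); split.
- apply: continuous_compact; last first.
    by apply: compact_setX => //; exact: segment_compact.
  exact/continuous_subspaceT/continuous_join.
- apply/convexP => _ _ s s0 s1 [[t z] [/seg01[/= t0 t1] /= Kz] <-]
    [[t' z'] [/seg01[/= t'0 t'1] /= Kz'] <-].
  pose T := s * t + (1 - s) * t'.
  have s1' : 0 <= 1 - s by rewrite subr_ge0.
  have st0 : 0 <= s * t by rewrite mulr_ge0.
  have st0' : 0 <= (1 - s) * t' by rewrite mulr_ge0.
  have [T0|Tn0] := eqVneq T 0.
    (* the combination is a itself, and T cannot serve as a denominator *)
    exists (0, z0).
      by split=> //; apply/seg01; rewrite /= lexx ler01.
    rewrite /F /=.
    have st : s * t = 0 by rewrite /T in T0; lra.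
    have st' : (1 - s) * t' = 0 by rewrite /T in T0; lra.
    apply: vecP; rewrite !mxE.
    + transitivity (a ord0 0 + s * t * (z ord0 0 - a ord0 0) +
        (1 - s) * t' * (z' ord0 0 - a ord0 0)); last ring.
      by rewrite st st'; ring.
    + transitivity (a ord0 1 + s * t * (z ord0 1 - a ord0 1) +
        (1 - s) * t' * (z' ord0 1 - a ord0 1)); last ring.
      by rewrite st st'; ring.
  have T0 : 0 < T by rewrite lt_def Tn0 addr_ge0.
  have T1 : T <= 1.
    have := ler_wpM2l s0 t1; have := ler_wpM2l s1' t'1; rewrite /T; lra.
  exists (T, (s * t / T) *: z + (1 - s * t / T) *: z').
    split; first by apply/seg01; split=> //; exact: ltW.
    apply: xK => //; first by rewrite divr_ge0 // ltW.
    by rewrite ler_pdivrMr // mul1r /T; lra.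
  rewrite /F /=; have e k : T * (k / T) = k by field.
  have e' : T * (1 - s * t / T) = (1 - s) * t' by rewrite mulrBr e /T; ring.
  rewrite scalerDr !scalerA e e' /T.
  by apply: vecP; rewrite !mxE; ring.
- move=> z Kz; exists (1, z); first by split=> //; apply/seg01; rewrite ler01 lexx.
  by rewrite /F /= subrr scale0r scale1r addr0.
- exists (0, z0); first by split=> //; apply/seg01; rewrite ler01 lexx.
  by rewrite /F /= subr0 scale0r scale1r add0r.
- move=> _ [[t z] [/seg01[t0 t1] Kz] <-]; rewrite /F /=.
  by apply: Conv_convex => //; apply: sub_Conv; [left|right].
Qed.

Lemma join_points (R : realType) (K : set 'rV[R]_2) (l : seq 'rV[R]_2) :
  K !=set0 -> compact K -> @convex_set R 'rV[R]_2 K ->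
  exists E : set 'rV[R]_2, [/\ compact E, @convex_set R 'rV[R]_2 E,
    K `<=` E, [set` l] `<=` E & E `<=` Conv (K `|` [set` l])].
Proof.
move=> K0 cK xK; elim: l => [|a l [E [cE xE KE lE EC]]].
  by exists K; split=> // z Kz; apply: sub_Conv; left.
have E0 : E !=set0 by case: K0 => z /KE; exists z.
have [F [cF xF EF Fa FC]] := join_point a E0 cE xE.
exists F; split=> //; first exact: subset_trans EF.
  by move=> z /=; rewrite inE => /orP[/eqP ->//|/lE /EF].
apply: subset_trans FC _; apply: Conv_sub; first exact: Conv_convex.
move=> z [/EC|->]; last by apply: sub_Conv; right; rewrite /= inE eqxx.
apply: Conv_sub z; first exact: Conv_convex.
by move=> z [Kz|lz]; apply: sub_Conv; [left|right; rewrite /= inE; apply/orP; right].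
Qed.

Lemma separation_hull (R : realType) (K : set 'rV[R]_2) (A : 'I_3 -> 'rV[R]_2) j p :
  K !=set0 -> compact K -> @convex_set R 'rV[R]_2 K ->
  ~ Conv (K `|` (range A `\` [set A j])) p ->
  exists n, (forall z, K z -> dot n z < dot n p) /\
    (forall i, A i != A j -> dot n (A i) < dot n p).
Proof.
move=> K0 cK xK np.
have [E [cE xE KE lE EC]] := join_points
  [seq A i | i <- enum 'I_3 & A i != A j] K0 cK xK.
have lS z : z \in [seq A i | i <- enum 'I_3 & A i != A j] ->
    (range A `\` [set A j]) z.
  by move=> /mapP[i]; rewrite mem_filter => /andP[/eqP ij _] ->; split; [exists i|].
have Ep : ~ E p.
  move=> /EC Ep; apply: np; apply: Conv_sub Ep; first exact: Conv_convex.
  by move=> z [Kz|/lS Sz]; apply: sub_Conv; [left|right].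
have E0 : E !=set0 by case: K0 => z /KE; exists z.
have [n _ sep] := separation E0 cE xE Ep.
exists n; split=> [z /KE|i ij]; first exact: sep.
by apply/sep/lE; rewrite /= map_f // mem_filter ij mem_enum.
Qed.

(** * Two discs in a triangle *)

(** A line meets the unit circle in at most two points:
    with the component along v fixed, the orthogonal component is determined up
    to sign. *)
Lemma unit_dot_two (R : realType) (v e0 e1 e2 : 'rV[R]_2) :
  v != 0 -> dot e0 e0 = 1 -> dot e1 e1 = 1 -> dot e2 e2 = 1 ->
  dot e1 v = dot e0 v -> dot e2 v = dot e0 v ->
  [\/ e1 = e0, e2 = e0 | e1 = e2].
Proof.
move=> v0 u0 u1 u2 h1 h2.
have vv := dot_gt0 v0; have vvn : dot v v != 0 by rewrite gt_eqF.
have cv : cross v (perp v) != 0.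
  by rewrite (_ : cross _ _ = dot v v) // /cross /dot /perp !mxE /=; ring.
have sq e : dot e e * dot v v = dot e v ^+ 2 + cross v e ^+ 2.
  by rewrite /dot /cross; ring.
have ext e e' : dot e v = dot e' v -> cross v e = cross v e' -> e = e'.
  move=> hd hc; apply: (dot_ext cv); first by rewrite dotC hd dotC.
  by rewrite dotC dot_perp hc -dot_perp dotC.
have same e : dot e e = 1 -> dot e v = dot e0 v ->
    cross v e = cross v e0 \/ cross v e = - cross v e0.
  move=> ue he; have := sq e; rewrite ue he -u0 sq => /addrI/esym/eqP.
  by rewrite eqf_sqr => /orP[/eqP|/eqP]; [left|right].
have [c1|c1] := same _ u1 h1; first by apply: Or31; exact: ext.
have [c2|c2] := same _ u2 h2; first by apply: Or32; exact: ext.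
by apply: Or33; apply: ext; rewrite ?h1 ?h2 ?c1 ?c2.
Qed.

(** The intermediate value theorem on the segment from n to m, for the
    difference of the support functions of two discs. *)
Lemma sign_change_root (R : realType) (v n m : 'rV[R]_2) (rho : R) :
  0 < dot n v + rho * Num.sqrt (dot n n) ->
  dot m v + rho * Num.sqrt (dot m m) < 0 ->
  exists2 t, 0 <= t <= 1 & let z := (1 - t) *: n + t *: m in
    dot z v + rho * Num.sqrt (dot z z) = 0.
Proof.
move=> hn hm.
pose F (z : 'rV[R]_2) := dot v z + rho * Num.sqrt (dot (z - 0) (z - 0)).
pose z (t : R) : 'rV[R]_2 := (1 - t) *: n + t *: m.
have FE w : F w = dot w v + rho * Num.sqrt (dot w w) by rewrite /F subr0 dotC.
have cF : continuous F.
  move=> w.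
  have cs : {for w, continuous (fun w : 'rV[R]_2 => Num.sqrt (dot (w - 0) (w - 0)))}.
    exact: (continuous_comp (@continuous_dot_sub R 0 w) (@sqrt_continuous R _)).
  have cr := @continuousM R _ (fun=> rho) _ w (@cst_continuous _ _ _ w) cs.
  exact: (@continuousD R R^o _ _ _ w (@continuous_dot R v w) cr).
have cz : continuous z.
  move=> t; have ct : {for t, continuous (fun t : R => t)} by exact: cvg_id.
  have c1 := @continuousB R R^o _ (fun=> 1) _ t (@cst_continuous _ _ _ t) ct.
  have h1 := @continuousZ R 'rV[R]_2 _ _ (fun=> n) t c1 (@cst_continuous _ _ _ t).
  have h2 := @continuousZ R 'rV[R]_2 _ _ (fun=> m) t ct (@cst_continuous _ _ _ t).
  exact: (@continuousD R 'rV[R]_2 _ _ _ t h1 h2).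
have cg : continuous (F \o z).
  by move=> t; exact: (continuous_comp (cz t) (cF (z t))).
have g0 : 0 < F (z 0) by rewrite FE /z subr0 scale1r scale0r addr0.
have g1 : F (z 1) < 0 by rewrite FE /z subrr scale1r scale0r add0r.
have [|t] := @IVT R (F \o z) 0 1 0 ler01 (continuous_subspaceT cg).
  by rewrite /= ge_min le_max (ltW g1) (ltW g0) orbT.
by rewrite in_itv /= FE => t01 gt; exists t.
Qed.

(** The directions in which the triangle reaches furthest at A j only.  Vertices
    equal to A j are left out of the comparison, in accordance with the
    vertices that are removed together with A j. *)
Definition vertex_cone (R : realType) (A : 'I_3 -> 'rV[R]_2) j : set 'rV[R]_2 :=
  [set n | forall i, A i != A j -> dot n (A i) < dot n (A j)].

Lemma vertex_coneP (R : realType) (A : 'I_3 -> 'rV[R]_2) j n p :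
  Conv (range A) p -> (forall i, A i != A j -> dot n (A i) < dot n p) ->
  vertex_cone A j n.
Proof.
move=> /(Conv_attains n) [_ [i _ <-] le] h k kj; apply: lt_le_trans (h k kj) _.
by have [<-//|/h] := eqVneq (A i) (A j); rewrite ltNge le.
Qed.

Lemma third_index (e f : 'I_3) : e != f ->
  exists g, forall i, [|| i == e, i == f | i == g].
Proof.
elim/ord3_cases: e; elim/ord3_cases: f => // _;
  [exists 2|exists 1|exists 2|exists 0|exists 1|exists 0];
  by elim/ord3_cases.
Qed.

(** If A e = A f, both sets lie on the line through A e and the third vertex
    A g.  A functional in the cone of A e does not decrease from A g to A e, so n
    puts p strictly nearer to A e than q, and m does the opposite. *)
Lemma no_opposite_caps_at_double_vertex (R : realType) (K0 K1 : set 'rV[R]_2)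
    (A : 'I_3 -> 'rV[R]_2) e f :
  e != f -> A e = A f -> K0 `<=` Conv (range A) -> K1 `<=` Conv (range A) ->
  forall n m p q, vertex_cone A e n -> vertex_cone A e m ->
  K1 p -> K0 q -> (forall z, K0 z -> dot n z < dot n p) ->
  (forall z, K1 z -> dot m z < dot m q) -> False.
Proof.
move=> ef Aef sK0 sK1 n m p q cn cm K1p K0q hn hm.
have [g gP] : exists g, forall i, A i = A e \/ A i = A g.
  have [g gP] := third_index ef; exists g => i.
  by have /or3P[] := gP i => /eqP ->; rewrite ?Aef; [left|left|right].
have onL z : Conv (range A) z -> exists t, z = A g + t *: (A e - A g).
  move: z; apply: Conv_sub => [x y t _ _ [u ->] [v ->]|_ [i _ <-]].
    exists (t * u + (1 - t) * v).
    by apply: vecP; rewrite !mxE; ring.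
  have [->|->] := gP i; [exists 1|exists 0]; first by rewrite scale1r addrC subrK.
  by rewrite scale0r addr0.
have [t pE] := onL _ (sK1 _ K1p); have [u qE] := onL _ (sK0 _ K0q).
have pos k : vertex_cone A e k -> 0 <= dot k (A e - A g).
  move=> ck; rewrite dotBr subr_ge0.
  by have [->//|/ck/ltW] := eqVneq (A g) (A e).
have := hn _ K0q; have := hm _ K1p; rewrite pE qE !(dotDr _ (A g)) !dotZr.
rewrite !ltrD2l => hm' hn'; have [tu|/ltW ut] := leP t u.
  by have := ler_wpM2r (pos _ cn) tu; rewrite leNgt hn'.
by have := ler_wpM2r (pos _ cm) ut; rewrite leNgt hm'.
Qed.

(** The functional separating a point p of the second disc also lies in the
    cone of A j, because p cannot exceed every vertex of the triangle. *)
Lemma disc_cap (R : realType) (c c' : 'rV[R]_2) (r r' : R) (A : 'I_3 -> 'rV[R]_2) j :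
  0 <= r -> compact (disc c r) -> disc c' r' `<=` Conv (range A) ->
  ~ (disc c' r' `<=` Conv (disc c r `|` (range A `\` [set A j]))) ->
  exists n p, [/\ disc c' r' p, forall z, disc c r z -> dot n z < dot n p &
    vertex_cone A j n].
Proof.
move=> r0 cD sD' H.
have xD : @convex_set R 'rV[R]_2 (disc c r).
  by rewrite -Conv_circle //; apply/convexP; exact: Conv_convex.
have nD : disc c r !=set0 by exists c; rewrite /disc /= subrr dot0l sqrtr0.
have [p [D'p np]] : exists p, disc c' r' p /\
    ~ Conv (disc c r `|` (range A `\` [set A j])) p.
  apply: contrapT => h; apply: H => p D'p.
  by apply: contrapT => np; apply: h; exists p.
have [n [hK hA]] := separation_hull nD cD xD np; exists n, p; split=> //.
exact: vertex_coneP (sD' _ D'p) hA.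
Qed.

(** If the property fails, f changes sign in each of three disjoint convex
    cones, so it has three distinct zeros on the unit circle. *)
Lemma discs_one_in_hull (R : realType) (c0 c1 : 'rV[R]_2) (r0 r1 : R)
    (A : 'I_3 -> 'rV[R]_2) :
  0 <= r0 -> 0 <= r1 -> compact (disc c0 r0) -> compact (disc c1 r1) ->
  disc c0 r0 `<=` Conv (range A) -> disc c1 r1 `<=` Conv (range A) ->
  one_in_hull_of_other (disc c0 r0) (disc c1 r1) A.
Proof.
move=> r00 r10 cD0 cD1 sD0 sD1; apply: contrapT => H.
have up j : exists n p, [/\ disc c1 r1 p,
    forall z, disc c0 r0 z -> dot n z < dot n p & vertex_cone A j n].
  by apply: disc_cap => // h; apply: H; exists j, false.
have dn j : exists n p, [/\ disc c0 r0 p,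
    forall z, disc c1 r1 z -> dot n z < dot n p & vertex_cone A j n].
  by apply: disc_cap => // h; apply: H; exists j, true.
have injA i j : A i = A j -> i = j.
  move=> Aij; apply/eqP; apply: contrapT => /negP ij.
  have [n [p [D1p hn cn]]] := up i; have [m [q [D0q hm cm]]] := dn i.
  exact: (no_opposite_caps_at_double_vertex ij Aij sD0 sD1 cn cm D1p D0q hn hm).
pose v := c1 - c0; pose rho := r1 - r0.
pose f (n : 'rV[R]_2) := dot n v + rho * Num.sqrt (dot n n).
have fup j : exists2 n, vertex_cone A j n & 0 < f n.
  have [n [p [D1p hn cn]]] := up j; exists n => //.
  have [q D0q qE] := disc_dot_attained c0 n r00.
  have := hn _ D0q; have := disc_dot_le n D1p; rewrite qE /f /v /rho dotBr; lra.
have fdn j : exists2 n, vertex_cone A j n & f n < 0.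
  have [n [p [D0p hn cn]]] := dn j; exists n => //.
  have [q D1q qE] := disc_dot_attained c1 n r10.
  have := hn _ D1q; have := disc_dot_le n D0p; rewrite qE /f /v /rho dotBr; lra.
have root j : exists e, [/\ dot e e = 1, vertex_cone A j e & dot e v = - rho].
  have [n cn fn] := fup j; have [m cm fm] := fdn j.
  have [t /andP[t0 t1]] := sign_change_root fn fm.
  set z := _ + _ => /= fz.
  have cz : vertex_cone A j z.
    move=> i ij; rewrite -subr_gt0 -dotBr /z dotDl !dotZl.
    have hn := cn i ij; have hm := cm i ij.
    have := @avg_lt _ t (- dot m (A j - A i)) (- dot n (A j - A i)) 0 t0 t1.
    by rewrite !dotBr; lra.
  have zn0 : z != 0.
    apply/eqP => z0; have [k kj] : exists k : 'I_3, k != j.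
      by exists (if j == 0 then 1 else 0); case: ifP => [/eqP ->|/negbT]; rewrite // eq_sym.
    have : A k != A j by apply: contra_neq kj; exact: injA.
    by move=> /cz; rewrite z0 !dot0l ltxx.
  have [e e1 zE] := polar z; exists e.
  have s0 : 0 < Num.sqrt (dot z z) by rewrite sqrtr_gt0 dot_gt0.
  split=> //.
    by move=> i ij; have := cz i ij; rewrite zE !dotZl ltr_pM2l.
  apply: (mulfI (lt0r_neq0 s0)); rewrite -dotZl -zE; lra.
have [e0 [u0 k0 v0]] := root 0; have [e1 [u1 k1 v1]] := root 1.
have [e2 [u2 k2 v2]] := root 2.
have vn0 : v != 0.
  apply/eqP => vz; have [n _] := fup 0; rewrite /f vz.
  have -> : rho = 0 by rewrite -[rho]opprK -v0 vz dotC dot0l oppr0.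
  by rewrite dotC dot0l mul0r addr0 ltxx.
have disj i j e : i != j -> vertex_cone A i e -> vertex_cone A j e -> False.
  move=> ij ci cj; have Aij : A i != A j by apply: contra_neq ij; exact: injA.
  have := cj _ Aij; rewrite eq_sym in Aij; have := ci _ Aij.
  by move=> /lt_trans h /h; rewrite ltxx.
have d1 : dot e1 v = dot e0 v by rewrite v0 v1.
have d2 : dot e2 v = dot e0 v by rewrite v0 v2.
have [E|E|E] := unit_dot_two vn0 u0 u1 u2 d1 d2.
- by rewrite E in k1; exact: (disj 0 1 e0).
- by rewrite E in k2; exact: (disj 0 2 e0).
- by rewrite E in k1; exact: (disj 1 2 e2).
Qed.

Theorem theorem1p1 (R : realType) (K0 : set 'rV[R]_2)
    (K0_nonempty : K0 !=set0) (K0_compact : compact K0)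
    (K0_convex : @convex_set R 'rV[R]_2 K0) :
  [<-> is_disk K0;
       forall (K1 : set 'rV[R]_2) (A : 'I_3 -> 'rV[R]_2),
         are_similar K0 K1 ->
         K0 `<=` Conv (range A) -> K1 `<=` Conv (range A) ->
         one_in_hull_of_other K0 K1 A;
       forall (K1 : set 'rV[R]_2) (A : 'I_3 -> 'rV[R]_2),
         are_isometric K0 K1 ->
         K0 `<=` Conv (range A) -> K1 `<=` Conv (range A) ->
         one_in_hull_of_other K0 K1 A].
Proof.
tfae.
- move=> [c [r r0 K0E]] K1 A [phi [k k0 phiE] ->].
  rewrite Conv_circle // in K0E; rewrite K0E in K0_compact *.
  rewrite (similar_disc c r k0 phiE) => sK0 sK1.
  apply: discs_one_in_hull => //; first by rewrite mulr_ge0 // ltW.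
  exact: compact_disc_scale k0 K0_compact.
- move=> H K1 A [phi phi_iso K1E]; apply: H; exists phi => //.
  by exists 1 => // x y; rewrite mul1r.
- exact: disk_of_isometric_hull_property.
Qed.
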